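(* Let $m,k,i$ be positive integers and $q=2^m$. Then $$f(x)=x^{2^k+1}+x^{(2^k+1)q}+x^{(2^k+1)q^2}+x^{2^i}+x^{2^i q}$$ is a permutation polynomial over $\mathbb{F}_{q^3}$ if and only if $\gcd(2^k+1,q-1)=1$.
   Context: $\mathbb{F}_{q^3}$ denotes the finite field with $q^3$ elements. A polynomial $f\in\mathbb{F}_{q^3}[x]$ is a permutation polynomial over $\mathbb{F}_{q^3}$ if the associated map $c\mapsto f(c)$ from $\mathbb{F}_{q^3}$ to itself is a bijection. *)

(* Defs.v *)
From mathcomp Require Import all_boot all_order all_algebra.

Set Implicit Arguments.
Unset Strict Implicit.
Unset Printing Implicit Defensive.

Import GRing.Theory.
Local Open Scope ring_scope.

Definition permutation_poly (F : finFieldType) (f : {poly F}) : Prop :=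
  bijective (fun c : F => f.[c]).

(* Main.v *)
(* Write d = 2^k + 1, let Tr be the trace from F_{q^3} to F_q, and let
   T = Tr y.  Since Tr z = z for z in F_q in characteristic 2, f restricts
   to z |-> z^d on F_q, which is injective iff gcd(d, q - 1) = 1.
   Conversely f x determines Tr (f x) = Tr (x^d), hence x^(2^i) + x^(2^i q);
   so f x = f y forces a = x - y to lie in F_q.  Expanding the (2^k + 1)-th
   powers gives Tr ((y + a)^d) - Tr (y^d) = (T + a)^d - T^d, and injectivity
   of z |-> z^d on F_q yields a = 0. *)
Require Import Defs.
From mathcomp Require Import all_boot all_order all_algebra.
From mathcomp Require Import all_fingroup all_solvable all_field ring.

Set Implicit Arguments.
Unset Strict Implicit.
Unset Printing Implicit Defensive.

Import GRing.Theory.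
Local Open Scope ring_scope.

Lemma expr_gcdn_eq1 (F : fieldType) (w : F) (m n : nat) :
  (0 < m)%N -> w ^+ m = 1 -> w ^+ n = 1 -> w ^+ gcdn m n = 1.
Proof.
move=> m0 wm wn; case: (egcdnP n m0) => km kn e _.
have : w ^+ (km * m) = 1 by rewrite mulnC exprM wm expr1n.
by rewrite e exprD mulnC exprM wn expr1n mul1r.
Qed.

(** A nonzero [z] with [z ^+ q = z] is a [(q - 1)]-th root of unity, so the order of [u / v] divides
    both [d] and [q - 1]. Zero is treated first to allow the quotient. *)
Lemma expr_inj_fixed (F : fieldType) (d q : nat) (u v : F) :
  (0 < d)%N -> (0 < q)%N -> gcdn d (q - 1) = 1%N ->
  u ^+ q = u -> v ^+ q = v -> u ^+ d = v ^+ d -> u = v.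
Proof.
move=> d0 q0 g uq vq e.
have [v0|vN0] := eqVneq v 0.
  by move/eqP: e; rewrite v0 expr0n gtn_eqF // expf_eq0 d0 => /eqP.
have uN0 : u != 0.
  apply: contraNneq vN0 => u0.
  by move/esym/eqP: e; rewrite u0 expr0n gtn_eqF // expf_eq0 d0.
have fix1 (z : F) : z != 0 -> z ^+ q = z -> z ^+ (q - 1) = 1.
  move=> zN0 zq; apply: (mulfI zN0).
  by rewrite -exprS subn1 prednK // mulr1.
have : (u / v) ^+ gcdn d (q - 1) = 1.
  apply: expr_gcdn_eq1 => //; rewrite expr_div_n.
    by rewrite e divff // expf_neq0.
  by rewrite !fix1 // divr1.
by rewrite g expr1 => /divr1_eq.
Qed.

Lemma exists_root_of_unity (F : finFieldType) (p : nat) :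
  prime p -> (p %| #|F|.-1)%N -> exists2 u : F, u != 1 & u ^+ p = 1.
Proof.
move=> pp; rewrite -card_finField_unit => pd.
have [u _ ou] := Cauchy pp pd.
exists (val u).
  apply: contraTneq (prime_gt1 pp) => u1.
  have -> : p = 1%N by rewrite -ou (_ : u = 1%g) ?order1 //; apply: val_inj.
  by [].
by rewrite -FinRing.val_unitX -ou expg_order.
Qed.

Section CubicExtension.

Variables (F : finFieldType) (m k i : nat).
Let q := (2 ^ m)%N.
Let d := (2 ^ k + 1)%N.
Hypothesis char2 : 2%N \in [pchar F].
Hypothesis cardF : #|F| = (q ^ 3)%N.

(** The subfield of order [q] is never built: belonging to it is expressed as [z ^+ q = z]. *)
Definition trace3 (x : F) : F := x + x ^+ q + x ^+ (q ^ 2).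

Definition trinomial_map (x : F) : F :=
  trace3 (x ^+ d) + x ^+ (2 ^ i) + x ^+ (2 ^ i * q).

Lemma expr2D n (x y : F) : (x + y) ^+ (2 ^ n) = x ^+ (2 ^ n) + y ^+ (2 ^ n).
Proof. by apply: exprDn_pchar; rewrite pnatX (pnatE _ (isT : prime 2)) char2. Qed.

Lemma addxx (x : F) : x + x = 0.
Proof. exact: addrr_pchar2. Qed.

Lemma exprd (x : F) : x ^+ d = x ^+ (2 ^ k) * x.
Proof. by rewrite /d exprD expr1. Qed.

Lemma exprq3 (x : F) : (x ^+ (q ^ 2)) ^+ q = x.
Proof. by rewrite -exprM -expnSr -cardF expf_card. Qed.

Lemma exprqq (x : F) : x ^+ (q ^ 2) = (x ^+ q) ^+ q.
Proof. by rewrite -exprM. Qed.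

Lemma trace3_fixed (x : F) : trace3 x ^+ q = trace3 x.
Proof. by rewrite /trace3 !expr2D exprq3 -exprqq addrC addrA. Qed.

Lemma trace3_id (x : F) : x ^+ q = x -> trace3 x = x.
Proof. by move=> xq; rewrite /trace3 exprqq !xq addxx add0r. Qed.

Lemma trace3D (x y : F) : trace3 (x + y) = trace3 x + trace3 y.
Proof. by rewrite /trace3 !exprqq !expr2D; ring. Qed.

Lemma trace3_expq (x : F) : trace3 (x ^+ q) = trace3 x.
Proof. by rewrite /trace3 -!exprqq -exprM mulnC exprM exprq3; ring. Qed.

Lemma trinomial_map_fixed (z : F) : z ^+ q = z -> trinomial_map z = z ^+ d.
Proof.
(* The last two terms coincide when [z ^+ q = z], so they cancel in characteristic 2. *)
move=> zq; rewrite /trinomial_map mulnC exprM zq -addrA addxx addr0.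
by rewrite trace3_id // -exprM mulnC exprM zq.
Qed.

(** With [w = x ^+ (2 ^ i)], the tail is [w + w ^+ q], whose trace vanishes because [w] and [w ^+ q]
    have equal traces. *)
Lemma trace3_trinomial_map (x : F) :
  trace3 (trinomial_map x) = trace3 (x ^+ d).
Proof.
rewrite /trinomial_map exprM -addrA trace3D trace3_id ?trace3_fixed //.
by rewrite trace3D trace3_expq addxx addr0.
Qed.

Lemma trace3_expd_shift (y a : F) : a ^+ q = a ->
  trace3 ((y + a) ^+ d) - trace3 (y ^+ d)
    = (trace3 y + a) ^+ d - trace3 y ^+ d.
Proof.
move=> aq.
have E (z : F) n : (z ^+ d) ^+ n = (z ^+ n) ^+ (2 ^ k) * z ^+ n.
  by rewrite -exprM mulnC exprM exprd.
rewrite /trace3 !E !exprqq !expr2D !aq !exprd !expr2D.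
(* The three conjugates contribute [a ^+ d] three times on the left, against once on the right;
   adding the vanishing double makes this an identity of commutative rings. *)
rewrite -[RHS]addr0 -(addxx (a ^+ (2 ^ k) * a)); ring.
Qed.

Lemma trinomial_map_diff_fixed (x y : F) :
  trinomial_map x = trinomial_map y -> (x - y) ^+ q = x - y.
Proof.
move=> e.
have D : trace3 (x ^+ d) = trace3 (y ^+ d).
  by rewrite -!trace3_trinomial_map e.
move: e; rewrite /trinomial_map D -(addrA _ (x ^+ _)) -(addrA _ (y ^+ _)) => /addrI.
rewrite !(mulnC (2 ^ i)%N) !exprM -!expr2D => e.
have s0 : (x + x ^+ q + (y + y ^+ q)) ^+ (2 ^ i) = 0.
  by rewrite expr2D e addxx.
move/eqP: s0; rewrite expf_eq0 => /andP[_ /eqP s0].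
apply/eqP; rewrite -subr_eq0 !(oppr_pchar2 char2) expr2D -s0.
by apply/eqP; ring.
Qed.

Lemma trinomial_map_inj : gcdn d (q - 1) = 1%N -> injective trinomial_map.
Proof.
move=> g x y e; have aq := trinomial_map_diff_fixed e.
have := trace3_expd_shift y aq.
rewrite (addrC y (x - y)) subrK -!trace3_trinomial_map e subrr => /esym/subr0_eq D.
have d0 : (0 < d)%N by rewrite /d addn1.
have q0 : (0 < q)%N by rewrite /q expn_gt0.
have := expr_inj_fixed d0 q0 g _ (trace3_fixed y) D.
rewrite expr2D trace3_fixed aq => /(_ erefl) /eqP.
by rewrite -subr_eq0 addrAC subrr add0r subr_eq0 => /eqP.
Qed.

(** A prime [p] dividing the gcd yields [u != 1] with [u ^+ p = 1]. As [p] divides [q - 1], [u] is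
    fixed by the [q]-th power; as [p] divides [d], both [u] and 1 are sent to 1. *)
Lemma trinomial_map_inj_gcd :
  injective trinomial_map -> gcdn d (q - 1) = 1%N.
Proof.
move=> finj; apply/eqP; apply: contraT => gN1.
have g1 : (1 < gcdn d (q - 1))%N.
  by rewrite ltn_neqAle eq_sym gN1 gcdn_gt0 /d addn1.
pose p := pdiv (gcdn d (q - 1)).
have pp : prime p := pdiv_prime g1.
have := pdiv_dvd (gcdn d (q - 1)); rewrite -/p dvdn_gcd => /andP[pd pq].
have q0 : (0 < q)%N by rewrite /q expn_gt0.
have pF : (p %| #|F|.-1)%N.
  by rewrite cardF predn_exp -subn1 dvdn_mulr.
have [u uN1 up] := exists_root_of_unity pp pF.
have upM n : (p %| n)%N -> u ^+ n = 1.
  by case/dvdnP=> c ->; rewrite mulnC exprM up expr1n.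
have uq : u ^+ q = u by rewrite -(subnK q0) exprD upM // mul1r.
case/eqP: uN1; apply: finj.
by rewrite !trinomial_map_fixed ?expr1n // upM.
Qed.

End CubicExtension.

Theorem theorem3p11 (m k i q : nat) (F : finFieldType)
    (hm : (0 < m)%N) (hk : (0 < k)%N) (hi : (0 < i)%N)
    (hq : q = (2 ^ m)%N) (hF : #|F| = (q ^ 3)%N) :
  permutation_poly
    ('X^(2 ^ k + 1) + 'X^((2 ^ k + 1) * q) + 'X^((2 ^ k + 1) * q ^ 2)
     + 'X^(2 ^ i) + 'X^(2 ^ i * q) : {poly F})
  <-> gcdn (2 ^ k + 1) (q - 1) = 1%N.
Proof.
subst q.
have char2 : 2%N \in [pchar F].
  by apply: (@card_finPcharP F 2 (m * 3)); rewrite // hF expnM.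
rewrite /permutation_poly; set f := fun c : F => _.
have fE : f =1 trinomial_map m k i (F := F).
  by move=> c; rewrite /f !hornerD !hornerXn /trinomial_map /trace3 -!exprM.
split=> [/bij_inj finj | g].
  apply: (trinomial_map_inj_gcd (i := i) char2 hF).
  exact: eq_inj finj fE.
apply: injF_bij; apply: (eq_inj (trinomial_map_inj (i := i) char2 hF g)).
by move=> x; rewrite fE.
Qed.
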